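(* The rational Gaussian singlet $\overline{\mathcal G}\langle\mathbb Q|\mathbb Q\rangle=[\mathcal F\colon\overline{\mathcal G(\mathbb Q)}\to\overline{\mathcal G(\mathbb Q)}]$ is the smallest Fourier (twain) subsinglet over the field $\mathbb Q^\pi$ of the Schwartz singlet $[\mathcal F\colon\mathcal S(\mathbb R)\to\mathcal S(\mathbb R)]$, taken over the rational Heisenberg group $H_{\mathbb Q}$, that contains the unit Gaussian $g(x)=e^{-\pi x^2}$. That is, $\overline{\mathcal G(\mathbb Q)}$ is the smallest $\mathbb Q^\pi$-linear subspace of $\mathcal S(\mathbb R)$ that contains $g$ and is closed under convolution, pointwise product, the action of $H_{\mathbb Q}$, and $\mathcal F$.
   Context: $\tau=2\pi$. $\mathcal S(\mathbb R)$ is the space of complex-valued Schwartz functions, with convolution $\star$ and pointwise product $\cdot$, and $\mathcal F s(\xi)=\int_{\mathbb R}e^{i\tau x\xi}s(x)\,dx$. $\mathbb Q^\pi:=\mathbb Q(e^{\pi\xi}\mid\xi\in\mathbb Q(i))\subset\mathbb C$ is the Gelfond field. $\overline{\mathcal G(\mathbb Q)}$ is the $\mathbb Q^\pi$-linear span in $\mathcal S(\mathbb R)$ of all $e_\alpha g_{\mu,\rho}$ with $\alpha,\mu\in\mathbb Q$, $\rho\in\mathbb Q_{>0}$, where $e_\alpha(x)=e^{i\tau\alpha x}$ and $g_{\mu,\rho}(x)=e^{-\pi\rho(x-\mu)^2}$; so $g=g_{0,1}$. The rational Heisenberg group $H_{\mathbb Q}$ consists of all $c(x,\xi)$ with $c$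 a root of unity and $x,\xi\in\mathbb Q$, with product $c(x,\xi)c'(x',\xi')=cc'e^{i\tau\xi x'}(x+x',\xi+\xi')$. It acts on $\mathcal S(\mathbb R)$ by $(x\bullet s)(y)=s(y-x)$, $(\xi\bullet s)(y)=e^{i\tau\xi y}s(y)$ and scalar multiplication by $c$ (on the spectral side by the same translations and modulations, as a right action: $(\sigma\bullet\xi)(\eta)=\sigma(\eta-\xi)$, $(\sigma\bullet x)(\eta)=e^{i\tau\eta x}\sigma(\eta)$). Fourier subsinglets are understood as twain subsinglets, i.e. closed under both products. *)

(* Defs.v *)
(* MathComp-Analysis; the complex numbers are [R[i]] for [R : realType]. *)
From HB Require Import structures.
From mathcomp Require Import all_boot all_order all_algebra.
From mathcomp Require Import complex.
From mathcomp Require Import ring.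
From mathcomp Require Import all_classical all_reals all_analysis.

Set Implicit Arguments.
Unset Strict Implicit.
Unset Printing Implicit Defensive.

Import Order.TTheory GRing.Theory Num.Theory.
Import numFieldNormedType.Exports.
Local Open Scope classical_set_scope.
Local Open Scope complex_scope.
Local Open Scope ring_scope.

Section defs.
Context {R : realType}.
Local Notation C := R[i].
Local Notation Re := (@complex.Re R).
Local Notation Im := (@complex.Im R).
Implicit Types (s t : R -> C) (V : set (R -> C)) (K : set C).

Definition tau : R := 2 * pi.

Definition cexp (z : C) : C := (expR (Re z))%:C * (cos (Im z) +i* sin (Im z)).

(* [echar t] is $e^{i\tau t}$ *)
Definition echar (t : R) : C := cexp (0 +i* (tau * t)).

(* Integral over the real line of a complex-valued function, componentwise;
   only meaningful when both components are integrable. *)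
Definition cintegral s : C :=
  (\int[lebesgue_measure]_(x in [set: R]) Re (s x))%R +i*
  (\int[lebesgue_measure]_(x in [set: R]) Im (s x))%R.

(* $\mathcal F s(\xi) = \int e^{i\tau x\xi} s(x)\,dx$: positive sign in the
   exponent. *)
Definition fourier s : R -> C :=
  fun xi => cintegral (fun x => echar (x * xi) * s x).

Definition convolution s t : R -> C :=
  fun x => cintegral (fun y => s y * t (x - y)).

Definition cderiven (n : nat) s : R -> C :=
  fun x => (Re \o s)^`(n)%classic x +i* (Im \o s)^`(n)%classic x.

Definition smooth (f : R -> R) : Prop :=
  forall (n : nat) (x : R), derivable f^`(n)%classic x 1.

Definition schwartz : set (R -> C) :=
  [set s : R -> C | [/\ smooth (Re \o s), smooth (Im \o s) &
    forall k n : nat, exists M : R, forall x : R,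
      (`|x| ^+ k)%:C * `|cderiven n s x| <= M%:C]].

(* Gelfond field Q(e^{pi xi} | xi in Q(i)): the least subfield of C containing
   the generators. [divring_closed K] says that K contains 1 and is closed
   under subtraction and division. *)
Definition gelfond : set C :=
  smallest [set K : set C | GRing.divring_closed [in K]]
    [set cexp ((pi * ratr p.1) +i* (pi * ratr p.2)) | p in [set: rat * rat]].

Definition modulation (alpha : R) : R -> C := fun x => echar (alpha * x).

Definition gaussian (mu rho : R) : R -> C :=
  fun x => (expR (- (pi * rho * (x - mu) ^+ 2)))%:C.

Definition rational_gaussians : set (R -> C) :=
  [set s : R -> C | exists n (c : 'I_n -> C) (alpha mu rho : 'I_n -> rat),
    [/\ forall j, gelfond (c j), forall j, 0 < rho j &
      s = fun x => \sum_(j < n)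
        c j * (modulation (ratr (alpha j)) x *
               gaussian (ratr (mu j)) (ratr (rho j)) x)]].

(* [Heis c x xi] is the element c(x, xi); [heisenbergQ] is the carrier of H_Q. *)
Record heis := Heis { hscal : C; hpos : R; hfreq : R }.

Definition heis_mul (h h' : heis) : heis :=
  Heis (hscal h * hscal h' * echar (hfreq h * hpos h'))
       (hpos h + hpos h') (hfreq h + hfreq h').

Definition heisenbergQ : set heis :=
  [set h | [/\ exists2 n : nat, (0 < n)%N & hscal h ^+ n = 1,
               exists q : rat, hpos h = ratr q &
               exists q : rat, hfreq h = ratr q]].

Definition translate (x : R) s : R -> C := fun y => s (y - x).

Definition modulate (xi : R) s : R -> C := fun y => modulation xi y * s y.

(* The product law gives c(x, xi) = c (x, 0) (0, xi), whence the order of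
   composition; see [heis_actM]. *)
Definition heis_act (h : heis) s : R -> C :=
  fun y => hscal h * translate (hpos h) (modulate (hfreq h) s) y.

(* Spectral side: positions modulate and frequencies translate, and being a
   right action (see [heis_ractM]) c(x, xi) acts first by x and then by xi. *)
Definition heis_ract s (h : heis) : R -> C :=
  fun eta => hscal h * translate (hfreq h) (modulate (hpos h) s) eta.

Definition linear_subspace K V : Prop :=
  [/\ V (cst 0),
      forall s t, V s -> V t -> V (s \+ t) &
      forall c s, K c -> V s -> V (fun x => c * s x)].

(* [fourier : V -> V] is a twain subsinglet, over the field K and over H_Q, of
   [fourier : schwartz -> schwartz]. V is both the signal and the spectral side;
   closure under [heis_ract] need not be listed, see [heis_ractE]. *)
Definition twain_subsinglet K V : Prop :=
  [/\ V `<=` schwartz /\ linear_subspace K V,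
      forall s t, V s -> V t -> V (convolution s t),
      forall s t, V s -> V t -> V (s \* t),
      forall h s, heisenbergQ h -> V s -> V (heis_act h s) &
      forall s, V s -> V (fourier s)].

Lemma echarD (a b : R) : echar (a + b) = echar a * echar b.
Proof.
rewrite /echar /cexp /= expR0 !mul1r mulrDr cosD sinD.
by apply/eqP; rewrite eq_complex /= [sin _ * cos _ + _]addrC !eqxx.
Qed.

Lemma heis_actM h h' s : heis_act (heis_mul h h') s = heis_act h (heis_act h' s).
Proof.
case: h h' => [c x xi] [c' x' xi']; apply/funext => y.
rewrite /heis_act /translate /modulate /modulation /= opprD addrA.
have E : echar (xi * x') * echar ((xi + xi') * (y - x - x')) =
    echar (xi * (y - x)) * echar (xi' * (y - x - x')).
  by rewrite -!echarD; congr echar; ring.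
transitivity (c * c' * s (y - x - x') *
    (echar (xi * x') * echar ((xi + xi') * (y - x - x')))); first by ring.
by rewrite E; ring.
Qed.

Lemma heis_ractM s h h' :
  heis_ract s (heis_mul h h') = heis_ract (heis_ract s h) h'.
Proof.
case: h h' => [c x xi] [c' x' xi']; apply/funext => y.
rewrite /heis_ract /translate /modulate /modulation /=.
rewrite [xi + xi']addrC opprD addrA.
have E : echar (xi * x') * echar ((x + x') * (y - xi' - xi)) =
    echar (x * (y - xi' - xi)) * echar (x' * (y - xi')).
  by rewrite -!echarD; congr echar; ring.
transitivity (c * c' * s (y - xi' - xi) *
    (echar (xi * x') * echar ((x + x') * (y - xi' - xi)))); first by ring.
by rewrite E; ring.
Qed.

Lemma heis_ractE s c x xi : heis_ract s (Heis c x xi) = heis_act (Heis c xi x) s.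
Proof. by []. Qed.

End defs.

(* Main.v *)
(* The wave packets e_a g_{m,r} are stable, up to explicit constants, under
   pointwise product, convolution, Fourier transform and the Heisenberg action.
   Everything rests on one integral, that of a wave packet, obtained from the
   linear differential equation which it satisfies as a function of the
   frequency. The constants are exp(pi q), e^{i tau q}, roots of unity and
   sqrt q for rational q; the last lie in the Gelfond field because it contains
   all roots of unity, and for odd n the product of the 1 - zeta^k over the
   nontrivial n-th roots of unity is both n and a square. Conversely,
   g_{0,m/n} is the m-th power of g_{0,1/n}, which is a multiple of the Fourier
   transform of the n-th power of g; the Heisenberg action gives the rest. *)
Require Import Defs.
From mathcomp Require Import all_boot all_order all_algebra.
From mathcomp Require Import complex.
From mathcomp Require Import ring lra zify.
From mathcomp Require Import all_classical all_reals all_analysis.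
From mathcomp Require Import measurable_realfun.
Import Order.TTheory GRing.Theory Num.Theory.
Import numFieldNormedType.Exports.
Local Open Scope classical_set_scope.
Local Open Scope complex_scope.
Local Open Scope ring_scope.

Set Implicit Arguments.
Unset Strict Implicit.
Unset Printing Implicit Defensive.

(** * Real Gaussian wave packets *)

Section real_gaussians.
Context {R : realType}.
Implicit Types (f g : R -> R) (a b m r x : R).
Local Notation mu := (@lebesgue_measure R).

(* The phase [b] makes sines members of the class. *)
Inductive gauss_class : (R -> R) -> Prop :=
| gauss_class_cos a b m r : 0 < r ->
    gauss_class (fun x => cos (a * x + b) * expR (- (r * (x - m) ^+ 2)))
| gauss_classD f g : gauss_class f -> gauss_class g ->
    gauss_class (fun x => f x + g x)
| gauss_classZ c f : gauss_class f -> gauss_class (fun x => c * f x)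
| gauss_classX f : gauss_class f -> gauss_class (fun x => x * f x).

Lemma gauss_class0 : gauss_class (fun=> 0).
Proof.
rewrite (_ : (fun=> 0) =
    fun x => 0 * (cos (0 * x + 0) * expR (- (1 * (x - 0) ^+ 2)))).
  by apply/gauss_classZ/gauss_class_cos.
by apply/funext => x; rewrite mul0r.
Qed.

Lemma gauss_class_sin a b m r : 0 < r ->
  gauss_class (fun x => sin (a * x + b) * expR (- (r * (x - m) ^+ 2))).
Proof.
move=> r0; rewrite (_ : (fun x => _) =
  fun x => cos (a * x + (b - pi / 2)) * expR (- (r * (x - m) ^+ 2))).
  exact: gauss_class_cos.
by apply/funext => x; rewrite addrA cosBpihalf.
Qed.

Lemma is_derive_cosgauss a b m r x :
  is_derive x 1 (fun x => cos (a * x + b) * expR (- (r * (x - m) ^+ 2)))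
    (- a * (sin (a * x + b) * expR (- (r * (x - m) ^+ 2))) -
     2 * r * ((x - m) * (cos (a * x + b) * expR (- (r * (x - m) ^+ 2))))).
Proof.
apply: is_derive_eq.
rewrite !scaler1 /GRing.scale /=; ring.
Qed.

(** A generator differentiates to a sine packet plus a linear polynomial times a cosine packet; the
    other constructors follow the sum and Leibniz rules. Continuity and smoothness of the whole
    class come from this. *)
Lemma gauss_class_derive f : gauss_class f ->
  exists2 f', gauss_class f' & forall x, is_derive x 1 f (f' x).
Proof.
elim=> [a b m r r0|g h _ [g' Gg' dg] _ [h' Gh' dh]|c g _ [g' Gg' dg]
  |g Gg [g' Gg' dg]].
- exists (fun x => - a * (sin (a * x + b) * expR (- (r * (x - m) ^+ 2))) +
    ((- (2 * r)) * (x * (cos (a * x + b) * expR (- (r * (x - m) ^+ 2)))) +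
     (2 * r * m) * (cos (a * x + b) * expR (- (r * (x - m) ^+ 2))))).
    apply: gauss_classD; first exact/gauss_classZ/gauss_class_sin.
    apply: gauss_classD; last by apply/gauss_classZ; exact: gauss_class_cos.
    by apply/gauss_classZ/gauss_classX; exact: gauss_class_cos.
  by move=> x; apply: is_derive_eq (is_derive_cosgauss _ _ _ _ _) _; ring.
- exists (fun x => g' x + h' x); first exact: gauss_classD.
  by move=> x; exact: is_deriveD.
- exists (fun x => c * g' x); first exact: gauss_classZ.
  by move=> x; exact: is_deriveZ.
- exists (fun x => g x + x * g' x).
    by apply: gauss_classD => //; exact: gauss_classX.
  move=> x; apply: is_derive_eq.
  by rewrite /GRing.scale /= mulr1 addrC.
Qed.

Lemma gauss_class_bound f : gauss_class f ->
  exists M c : R, [/\ 0 <= M, 0 < c &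
    forall x, `|f x| <= M * expR (- (c * x ^+ 2))].
Proof.
elim=> [a b m r r0|g h _ [M [c [M0 c0 gM]]] _ [N [d [N0 d0 hN]]]
  |k g _ [M [c [M0 c0 gM]]]|g Gg [M [c [M0 c0 gM]]]].
(* Half of the exponent absorbs the shift: $r m^2 + r(x-m)^2 - \frac r2 x^2 = \frac r2 (x-2m)^2 \ge
   0$. *)
- exists (expR (r * m ^+ 2)), (r / 2); split; [exact: expR_ge0|by lra|move=> x].
  rewrite normrM (ger0_norm (expR_ge0 _)) -expRD.
  apply: (@le_trans _ _ (1 * expR (- (r * (x - m) ^+ 2)))).
    by rewrite ler_wpM2r ?expR_ge0// ler_norml cos_geN1 cos_le1.
  rewrite mul1r ler_expR -subr_ge0.
  rewrite (_ : _ - _ = r / 2 * (x - 2 * m) ^+ 2); last by field.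
  by rewrite mulr_ge0 ?sqr_ge0// divr_ge0// ltW.
- exists (M + N), (Num.min c d); split; [exact: addr_ge0|by rewrite lt_min c0|].
  move=> x; rewrite mulrDl (le_trans (ler_normD _ _))// lerD//.
    rewrite (le_trans (gM x))// ler_wpM2l// ler_expR lerN2 ler_wpM2r ?sqr_ge0//.
    by rewrite ge_min lexx.
  rewrite (le_trans (hN x))// ler_wpM2l// ler_expR lerN2 ler_wpM2r ?sqr_ge0//.
  by rewrite ge_min lexx orbT.
- exists (`|k| * M), c; split => // [|x]; first by rewrite mulr_ge0.
  by rewrite normrM -mulrA ler_wpM2l.
(* Half of the decay pays for the factor [x]: $|x| \le 1 + x^2 \le (1 + 2/c)(1 + \frac c2 x^2) \le
   (1 + 2/c)\, e^{c x^2/2}$. *)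
- exists ((1 + 2 / c) * M), (c / 2); split; [|by lra|].
    by rewrite mulr_ge0// addr_ge0// divr_ge0// ltW.
  move=> x; rewrite normrM.
  rewrite (_ : - (c / 2 * x ^+ 2) = c / 2 * x ^+ 2 + - (c * x ^+ 2)); last by field.
  rewrite expRD mulrACA ler_pM//.
  apply: (@le_trans _ _ ((1 + 2 / c) * (1 + c / 2 * x ^+ 2))); last first.
    by rewrite ler_wpM2l ?expR_ge1Dx// addr_ge0// divr_ge0// ltW.
  have -> : (1 + 2 / c) * (1 + c / 2 * x ^+ 2) =
    (1 + x ^+ 2) + (2 / c + c / 2 * x ^+ 2) by field; rewrite gt_eqF.
  rewrite (@le_trans _ _ (1 + x ^+ 2))//.
    rewrite -real_normK ?num_real //.
    by have := sqr_ge0 (`|x| - 1); have := normr_ge0 x; nra.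
  have c0' := ltW c0.
  rewrite lerDl; apply: addr_ge0; first exact: divr_ge0.
  by apply: mulr_ge0; [exact: divr_ge0|exact: sqr_ge0].
Qed.

Lemma gauss_class_continuous f : gauss_class f -> continuous f.
Proof.
move=> /gauss_class_derive[f' _ df] x.
by apply: differentiable_continuous; apply/derivable1_diffP; case: (df x).
Qed.

Lemma gauss_class_measurable f (D : set R) :
  measurable D -> gauss_class f -> measurable_fun D f.
Proof.
move=> mD /gauss_class_continuous cf; apply: measurable_funTS.
exact: continuous_measurable_fun.
Qed.

(** The integrand is a multiple of the normal density with mean [m] and standard deviation $s =
    (2r)^{-1/2}$, whose total mass is 1. *)
Lemma Rintegral_gauss m r : 0 < r ->
  mu.-integrable [set: R] (EFin \o (fun x => expR (- (r * (x - m) ^+ 2)))) /\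
  \int[mu]_(x in [set: R]) expR (- (r * (x - m) ^+ 2)) = Num.sqrt (pi / r).
Proof.
move=> r0; pose s := (Num.sqrt (2 * r))^-1.
have r20 : 0 < 2 * r by lra.
have s0 : s != 0 by rewrite gt_eqF// invr_gt0 sqrtr_gt0.
have s2 : s ^+ 2 = (2 * r)^-1 by rewrite exprVn sqr_sqrtr// ltW.
have sE : s ^+ 2 * pi *+ 2 = pi / r.
  rewrite s2 -mulr_natl; field; rewrite gt_eqF//.
have k0 : 0 < Num.sqrt (pi / r) by rewrite sqrtr_gt0 divr_gt0 ?pi_gt0.
have E : (EFin \o (fun x => expR (- (r * (x - m) ^+ 2)))) =
    (fun x => (Num.sqrt (pi / r))%:E * (normal_pdf m s x)%:E)%E.
  apply/funext => x /=; rewrite normal_pdfE// /normal_peak /normal_fun sE -EFinM.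
  rewrite mulVKf ?gt_eqF//; congr (expR _)%:E.
  rewrite s2 -mulr_natl; field; rewrite gt_eqF//.
have I := integrable_normal_pdf m s.
split; first by rewrite E; exact: integrableZl.
rewrite /Rintegral.
under eq_integral => x _ do rewrite
  -[(expR _)%:E]/((EFin \o (fun x => expR (- (r * (x - m) ^+ 2)))) x) E.
by rewrite integralZl//= integral_normal_pdf mule1.
Qed.

Lemma gauss_class_integrable f : gauss_class f ->
  mu.-integrable [set: R] (EFin \o f).
Proof.
move=> Gf; have [M [c [M0 c0 fM]]] := gauss_class_bound Gf.
have [I _] := Rintegral_gauss 0 c0.
apply: (le_integrable _ _ _ (integrableZl _ M I)) => //.
  by apply/measurable_EFinP; exact: gauss_class_measurable.
move=> x _ /=; rewrite lee_fin subr0 (le_trans (fM x))// ger0_norm//.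
by rewrite mulr_ge0// expR_ge0.
Qed.

(** Since $x f(x)$ is again in the class, it is bounded by some [M], whence $|f(\pm n)| \le M/n$ for
    positive $n$. *)
Lemma gauss_class_cvg0 f : gauss_class f ->
  (f n%:R @[n --> \oo] --> (0 : R)) /\ (f (- n%:R) @[n --> \oo] --> (0 : R)).
Proof.
move=> Gf; have [M [c [M0 c0 fM]]] := gauss_class_bound (gauss_classX Gf).
have H (e : R) n : `|e| = 1 -> `|f (e * n.+1%:R)| <= M * n.+1%:R^-1.
  move=> e1; rewrite ler_pdivlMr ?ltr0n// mulrC.
  have := fM (e * n.+1%:R); rewrite 2!normrM e1 mul1r normr_nat => /le_trans; apply.
  rewrite ler_piMr// -[leRHS]expR0 ler_expR oppr_le0 mulr_ge0 ?sqr_ge0//.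
  exact: ltW.
have K (e : R) : `|e| = 1 -> f (e * n%:R) @[n --> \oo] --> (0 : R).
  move=> e1; rewrite -(@cvg_shiftS _ (fun n => f (e * n%:R))) /=.
  apply: norm_cvg0.
  apply: (@squeeze_cvgr _ _ _ _ (cst 0) (fun n => M * n.+1%:R^-1)).
  - by apply: nearW => n /=; rewrite normr_ge0 H.
  - exact: cvg_cst.
  - rewrite -[X in _ --> X](mulr0 M); apply: cvgMr; exact: cvg_harmonic.
split.
  by have := K 1 (normr1 _); under eq_fun do rewrite mul1r.
by have := K (-1) (normrN1 _); under eq_fun do rewrite mulN1r.
Qed.

(** The fundamental theorem of calculus on $[-(n+1), n+1]$ leaves boundary terms that tend to 0, and
    dominated convergence with bound $|f'|$ identifies the limit with the full integral. *)
Lemma Rintegral_gauss_class_derive f f' : gauss_class f -> gauss_class f' ->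
  (forall x, is_derive x 1 f (f' x)) -> \int[mu]_(x in [set: R]) f' x = 0.
Proof.
move=> Gf Gf' df.
have If' := gauss_class_integrable Gf'.
pose F n := (EFin \o (f' \_ `[- (n.+1%:R : R), n.+1%:R]%classic)).
have mF n : measurable_fun setT (F n).
  apply/measurable_EFinP/(measurable_restrictT f') => //.
  exact: gauss_class_measurable.
have Fcvg : \forall x \ae mu, [set: R] x -> F n x @[n --> \oo] --> (EFin \o f') x.
  apply: aeW => x _ /=; apply: cvg_near_cst; near=> n.
  rewrite /F /= patchE ifT//; apply/mem_set => /=; rewrite in_itv /= -ler_norml.
  near: n; have [k _ kx] := @nbhs_infty_ger R `|x|.
  exists k => // n /= kn; rewrite (le_trans (kx n kn))//.
  by rewrite ler_nat.
have Fle : \forall x \ae mu, forall n, [set: R] x ->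
    (`|F n x| <= (abse \o (EFin \o f')) x)%E.
  apply: aeW => x n _; rewrite /F /= lee_fin patchE.
  by case: ifPn => // _; rewrite normr0.
have [_ _] := @dominated_convergence _ _ _ mu setT measurableT F (EFin \o f') _
  mF (measurable_int mu If') Fcvg (integrable_abse If') Fle.
have FE n : (\int[mu]_x F n x)%E = (f n.+1%:R - f (- n.+1%:R))%:E.
  rewrite /F; rewrite -restrict_EFin -integral_mkcond.
  have n0 : - (n.+1%:R : R) < n.+1%:R by rewrite gtrN.
  rewrite (@continuous_FTC2 _ f' f) //.
  - apply: continuous_subspaceT; exact: gauss_class_continuous.
  - split; first by move=> x _; case: (df x).
    + by apply: cvg_at_right_filter; exact: gauss_class_continuous.
    + by apply: cvg_at_left_filter; exact: gauss_class_continuous.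
  - by move=> x _; rewrite derive1E; apply/derive_val.
under eq_fun do rewrite FE.
have H0 : f n.+1%:R - f (- n.+1%:R) @[n --> \oo] --> (0 : R).
  have [c1 c2] := gauss_class_cvg0 Gf.
  rewrite -[X in _ --> X](subr0 0); apply: cvgB.
    by rewrite (@cvg_shiftS _ (fun n => f n%:R)).
  by rewrite (@cvg_shiftS _ (fun n => f (- n%:R))).
have H1 : (f n.+1%:R - f (- n.+1%:R))%:E @[n --> \oo] --> (0 : R)%:E.
  by apply/fine_cvgP; split; [exact: nearW|exact: H0].
move=> H; rewrite /Rintegral.
by have /= <- := cvg_unique (@ereal_hausdorff R) H1 H.
Unshelve. all: end_near. Qed.

Lemma gauss_classXc f m : gauss_class f -> gauss_class (fun x => (x - m) * f x).
Proof.
move=> Gf; rewrite (_ : (fun x => _) = fun x => x * f x + (- m) * f x).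
  by apply: gauss_classD; [exact: gauss_classX|exact: gauss_classZ].
by apply/funext => x; rewrite mulrBl mulNr.
Qed.

(** Integration by parts: the derivative of the cosine packet has integral 0, and its two terms are
    the two sides up to constants. *)
Lemma Rintegral_cosgauss_moment a b m r : 0 < r ->
  \int[mu]_(x in [set: R])
    ((x - m) * (cos (a * x + b) * expR (- (r * (x - m) ^+ 2))))
  = - (a / (2 * r)) *
  \int[mu]_(x in [set: R]) (sin (a * x + b) * expR (- (r * (x - m) ^+ 2))).
Proof.
move=> r0.
have G1 := gauss_class_sin a b m r0.
have G2 := gauss_classXc m (gauss_class_cos a b m r0).
have := Rintegral_gauss_class_derive (gauss_class_cos a b m r0) _
  (is_derive_cosgauss a b m r).
have -> : (fun x : R => - a * (sin (a * x + b) * expR (- (r * (x - m) ^+ 2))) -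
     2 * r * ((x - m) * (cos (a * x + b) * expR (- (r * (x - m) ^+ 2))))) =
   (fun x : R => - a * (sin (a * x + b) * expR (- (r * (x - m) ^+ 2))) +
     (- (2 * r)) * ((x - m) * (cos (a * x + b) * expR (- (r * (x - m) ^+ 2))))).
  by apply/funext => x; rewrite !mulNr.
move=> /(_ (gauss_classD (gauss_classZ (- a) G1) (gauss_classZ _ G2))).
rewrite RintegralD//; [|exact/gauss_class_integrable/gauss_classZ..].
rewrite !RintegralZl//; [|exact/gauss_class_integrable..].
set I1 := Rintegral _ _ _; set I2 := Rintegral _ _ _ => E.
have r2 : 2 * r != 0 by rewrite gt_eqF//; lra.
apply: (mulfI r2); rewrite mulrA mulrN [_ * (a / _)]mulrC divfK//.
by apply/eqP; rewrite -subr_eq0; apply/eqP; rewrite -[RHS]oppr0 -E; ring.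
Qed.

(** With the phase at the centre held fixed, the integral is a function $\Phi$ of the frequency with
    $\Phi'(a) = -\frac{a}{2r}\Phi(a)$, and $\Phi(0)$ is a plain Gaussian integral. *)
Lemma Rintegral_cosgauss a b m r : 0 < r ->
  \int[mu]_(x in [set: R]) (cos (a * x + b) * expR (- (r * (x - m) ^+ 2)))
  = Num.sqrt (pi / r) * (cos (a * m + b) * expR (- (a ^+ 2 / (4 * r)))).
Proof.
move=> r0; pose c := a * m + b.
(* The phase at [x = m] is [c] for every [a], so differentiating in [a] brings out the factor
   [x - m]. *)
pose f a x := cos (a * x + (c - a * m)) * expR (- (r * (x - m) ^+ 2)).
pose Phi a := \int[mu]_(x in [set: R]) f a x.
have Gf a' : gauss_class (f a') by exact: gauss_class_cos.
have df (x a' : R) : is_derive a' 1 (f ^~ x)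
    (- ((x - m) * (cos (a' * x + (c - a' * m - pi / 2)) *
                   expR (- (r * (x - m) ^+ 2))))).
  rewrite addrA cosBpihalf /f; apply: is_derive_eq.
  by rewrite !scaler1 !scaler0 /GRing.scale /=; ring.
have dPhi a' : is_derive a' 1 Phi (- (a' / (2 * r)) * Phi a').
  (* At zero frequency and phase the cosine is 1, so $|G|$ bounds the derivative in the parameter
     uniformly, while [G] visibly stays in the class. *)
  pose G x := (x - m) * (cos (0 * x + 0) * expR (- (r * (x - m) ^+ 2))).
  have IG : mu.-integrable [set: R] (EFin \o (fun x => `|G x|)).
    by apply/integrable_norm/gauss_class_integrable/gauss_classXc/gauss_class_cos.
  have If x : `]a' - 1, a' + 1[%classic x -> mu.-integrable setT (EFin \o f x).
    by move=> _; exact: gauss_class_integrable.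
  have dfP x y : `]a' - 1, a' + 1[%classic x -> setT y -> derivable (f ^~ y) x 1.
    by move=> _ _; case: (df y x).
  have d1 x y : partial1of2 f x y =
      - ((y - m) * (cos (x * y + (c - x * m - pi / 2)) *
                    expR (- (r * (y - m) ^+ 2)))).
    by rewrite partial1of2E; apply: derive_val; exact: df.
  have Gub x y : `]a' - 1, a' + 1[%classic x -> setT y ->
      `|partial1of2 f x y| <= `|G y|.
    move=> _ _; rewrite d1 normrN /G mul0r addr0 cos0 mul1r.
    rewrite normrM [leRHS]normrM ler_wpM2l//.
    by rewrite normrM ler_piMl// ler_norml cos_geN1 cos_le1.
  have Ia : `]a' - 1, a' + 1[%classic a'.
    by rewrite /= in_itv /= gtrBl ltrDl ltr01.
  have G0 y : 0 <= `|G y| by [].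
  have D := derivable_under_integral measurableT Ia If dfP G0 IG Gub.
  have DE := differentiation_under_integral measurableT Ia If dfP G0 IG Gub.
  apply: DeriveDef => //; rewrite -derive1E DE.
  rewrite (@eq_Rintegral _ _ _ mu setT (fun y : R => -1 * ((y - m) *
    (cos (a' * y + (c - a' * m - pi / 2)) * expR (- (r * (y - m) ^+ 2)))))); last first.
    by move=> y _; rewrite d1 mulN1r.
  rewrite RintegralZl//; last first.
    by apply/gauss_class_integrable/gauss_classXc/gauss_class_cos.
  (* The moment formula produces a sine with phase shifted by $-\pi/2$; as $\sin(t - \pi/2) = -\cos
     t$, this is [Phi] again up to sign. *)
  rewrite Rintegral_cosgauss_moment// mulN1r mulNr opprK mulNr -mulrN; congr (_ * _).
  rewrite -mulN1r -RintegralZl//; last exact: gauss_class_integrable.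
  by apply: eq_Rintegral => y _; rewrite addrA sinBpihalf /f mulN1r mulNr.
(* Integrating factor of the differential equation: [H] is constant, hence equal to its value at
   0. *)
pose H a := Phi a * expR (a ^+ 2 / (4 * r)).
have r4 : 4 * r != 0 by rewrite gt_eqF//; lra.
have H' a' : is_derive a' 1 H 0.
  apply: is_derive_eq; rewrite /GRing.scale /=.
  by field; rewrite gt_eqF.
have := is_derive_0_is_cst a 0 H'.
have := expR_gt0 (a ^+ 2 / (4 * r)).
rewrite /H expr0n /= mul0r expR0 mulr1 => e0.
have -> : Phi 0 = Num.sqrt (pi / r) * cos c.
  rewrite /Phi /f !mul0r subr0.
  under eq_Rintegral => x _ do rewrite mul0r add0r.
  by have [I1 I2] := Rintegral_gauss m r0; rewrite RintegralZl// I2 mulrC.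
have -> : Phi a =
  \int[mu]_(x in [set: R]) (cos (a * x + b) * expR (- (r * (x - m) ^+ 2))).
  by apply: eq_Rintegral => x _; rewrite /f /c [a * m + b]addrC addrK.
by rewrite expRN mulrA => <-; rewrite mulfK// gt_eqF.
Qed.

End real_gaussians.

(** * Complex wave packets *)

Section complex_gaussians.
Context {R : realType}.
Local Notation C := R[i].
Implicit Types (s t : R -> C) (a b m r x y : R).
Local Notation mu := (@lebesgue_measure R).

Definition cgauss_class s :=
  gauss_class (fun x => complex.Re (s x)) /\
  gauss_class (fun x => complex.Im (s x)).

Lemma cgauss_class0 : cgauss_class (fun=> 0).
Proof. by split; exact: gauss_class0. Qed.

Lemma cgauss_classD s t : cgauss_class s -> cgauss_class t ->
  cgauss_class (fun x => s x + t x).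
Proof.
move=> [sR sI] [tR tI]; split.
  rewrite (_ : (fun x => _) = fun x => complex.Re (s x) + complex.Re (t x)).
    exact: gauss_classD.
  by apply/funext => x; case: (s x) (t x) => ? ? [].
rewrite (_ : (fun x => _) = fun x => complex.Im (s x) + complex.Im (t x)).
  exact: gauss_classD.
by apply/funext => x; case: (s x) (t x) => ? ? [].
Qed.

Lemma cgauss_classZ (c : C) s : cgauss_class s -> cgauss_class (fun x => c * s x).
Proof.
case: c => u v [sR sI]; split.
  rewrite (_ : (fun x => _) =
      fun x => u * complex.Re (s x) + (- v) * complex.Im (s x)).
    by apply: gauss_classD; exact: gauss_classZ.
  by apply/funext => x; case: (s x) => ? ?; rewrite mulNr.
rewrite (_ : (fun x => _) = fun x => u * complex.Im (s x) + v * complex.Re (s x)).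
  by apply: gauss_classD; exact: gauss_classZ.
by apply/funext => x; case: (s x).
Qed.

Lemma cintegral0 : cintegral (fun=> 0 : C) = 0.
Proof. by rewrite /cintegral /= Rintegral_cst// mul0r. Qed.

Lemma cintegralD s t : cgauss_class s -> cgauss_class t ->
  cintegral (fun x => s x + t x) = cintegral s + cintegral t.
Proof.
move=> [/gauss_class_integrable sR /gauss_class_integrable sI].
move=> [/gauss_class_integrable tR /gauss_class_integrable tI].
apply/eqP; rewrite eq_complex /=; apply/andP; split; apply/eqP.
  rewrite -RintegralD//; apply: eq_Rintegral => x _.
  by case: (s x) (t x) => ? ? [].
rewrite -RintegralD//; apply: eq_Rintegral => x _.
by case: (s x) (t x) => ? ? [].
Qed.

Lemma cintegralZ (c : C) s : cgauss_class s ->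
  cintegral (fun x => c * s x) = c * cintegral s.
Proof.
case: c => u v [sR sI].
have /gauss_class_integrable usR := gauss_classZ u sR.
have /gauss_class_integrable usI := gauss_classZ u sI.
have /gauss_class_integrable vsR := gauss_classZ v sR.
have /gauss_class_integrable vsI := gauss_classZ v sI.
move: sR sI => /gauss_class_integrable sR /gauss_class_integrable sI.
apply/eqP; rewrite eq_complex /=; apply/andP; split; apply/eqP.
  rewrite -!RintegralZl// -RintegralB//; apply: eq_Rintegral => x _.
  by case: (s x).
rewrite -!RintegralZl// -RintegralD//; apply: eq_Rintegral => x _.
by case: (s x).
Qed.

(** * Membership in the Schwartz space *)

Lemma gauss_class_derive1n (f : R -> R) n : gauss_class f -> gauss_class f^`(n)%classic.
Proof.
move=> Gf; elim: n => [|n IH]; first by rewrite derive1n0.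
have [g Gg dg] := gauss_class_derive IH.
rewrite derive1nS (_ : _^`()%classic = g)//.
by apply/funext => x; rewrite derive1E; apply: derive_val.
Qed.

Lemma gauss_class_smooth (f : R -> R) : gauss_class f -> smooth f.
Proof.
move=> Gf n x; have [g _ dg] := gauss_class_derive (gauss_class_derive1n n Gf).
by case: (dg x).
Qed.

Lemma gauss_class_decay (f : R -> R) k : gauss_class f ->
  exists M : R, forall x, `|x| ^+ k * `|f x| <= M.
Proof.
(* $x^k f$ is still in the class, so it has a Gaussian bound, and a Gaussian is at most 1. *)
move=> Gf; have [M [c [M0 c0 fM]]] : exists M c : R, [/\ 0 <= M, 0 < c &
    forall x, `|x ^+ k * f x| <= M * expR (- (c * x ^+ 2))].
  apply: gauss_class_bound; elim: k => [|k IH].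
    by under eq_fun do rewrite expr0 mul1r.
  by under eq_fun do rewrite exprS -mulrA; exact: gauss_classX.
exists M => x; rewrite -normrX -normrM (le_trans (fM x))// ler_piMr//.
rewrite -[leRHS]expR0 ler_expR oppr_le0 mulr_ge0 ?sqr_ge0//.
exact: ltW.
Qed.

Lemma normc_le_ReDIm (z : C) : `|z| <= (`|complex.Re z| + `|complex.Im z|)%:C.
Proof.
rewrite normc_def lecR -[leRHS]ger0_norm ?addr_ge0// -sqrtr_sqr ler_wsqrtr//.
rewrite sqrrD !real_normK ?num_real// -addrA lerD2l lerDr.
by rewrite mulrn_wge0// mulr_ge0.
Qed.

Lemma cgauss_class_schwartz s : cgauss_class s -> schwartz s.
Proof.
move=> [sR sI]; split; [exact: gauss_class_smooth|exact: gauss_class_smooth|move=> k n].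
have [M MP] := gauss_class_decay k (gauss_class_derive1n n sR).
have [N NP] := gauss_class_decay k (gauss_class_derive1n n sI).
exists (M + N) => x.
apply: le_trans (_ : (`|x| ^+ k)%:C * (`|complex.Re (cderiven n s x)| +
   `|complex.Im (cderiven n s x)|)%:C <= _).
  by rewrite ler_wpM2l ?normc_le_ReDIm// lecR exprn_ge0.
by rewrite -(rmorphM (real_complex R)) lecR mulrDr lerD.
Qed.

(** The function $e_a g_{m,r}$ at real parameters: all explicit formulas are proved here, and
    rationality enters only with the span. *)
Definition packet a m r : R -> C := fun x => modulation a x * gaussian m r x.

Lemma echarE a : echar a = cos (tau * a) +i* sin (tau * a).
Proof. by rewrite /echar /cexp expR0 mul1r. Qed.

(** The phase [+ 0] is kept so that both components have the shape of members of [gauss_class]. *)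
Lemma packetE a m r x : packet a m r x =
  (cos (tau * a * x + 0) * expR (- (pi * r * (x - m) ^+ 2))) +i*
  (sin (tau * a * x + 0) * expR (- (pi * r * (x - m) ^+ 2))).
Proof.
rewrite /packet /modulation /gaussian echarE addr0 mulrA.
by apply/eqP; rewrite eq_complex /= !mulr0 subr0 add0r !eqxx.
Qed.

Lemma cgauss_class_packet a m r : 0 < r -> cgauss_class (packet a m r).
Proof.
move=> r0; have pr : 0 < pi * r by rewrite mulr_gt0 ?pi_gt0.
rewrite /cgauss_class; under eq_fun do rewrite packetE /=.
split; [exact: gauss_class_cos|].
by under eq_fun do rewrite packetE /=; exact: gauss_class_sin.
Qed.

Lemma cintegral_packet a m r : 0 < r -> cintegral (packet a m r) =
  ((Num.sqrt r)^-1 * expR (- (pi * (a ^+ 2 / r))))%:C * echar (a * m).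
Proof.
move=> r0; have pr : 0 < pi * r by rewrite mulr_gt0 ?pi_gt0.
have p0 : pi != 0 :> R by rewrite gt_eqF ?pi_gt0.
have E : expR (- ((tau * a) ^+ 2 / (4 * (pi * r)))) = expR (- (pi * (a ^+ 2 / r))).
  congr expR; rewrite /tau; move: (pi : R) p0 => p p0.
  by field; rewrite p0 gt_eqF.
have S : Num.sqrt (pi / (pi * r)) = (Num.sqrt r)^-1.
  rewrite invfM mulVKf; [apply: sqrtrV; exact: ltW|exact: p0].
rewrite (funext (packetE a m r)) /cintegral echarE [tau * (a * m)]mulrA.
apply/eqP; rewrite eq_complex /=; apply/andP; split; apply/eqP.
  by rewrite Rintegral_cosgauss// E S addr0; ring.
(* The sine is a cosine with phase $-\pi/2$, so the cosine formula also gives the imaginary part. *)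
under eq_Rintegral => x _ do rewrite -cosBpihalf -addrA.
by rewrite Rintegral_cosgauss// E S add0r cosBpihalf; ring.
Qed.

End complex_gaussians.

(** * The Gelfond field *)

Section gelfond_field.
Context {R : realType}.
Local Notation C := R[i].
Implicit Types (z w : C) (a b r : R) (q : rat) (n : nat).
Local Notation K := (@gelfond R).

(** An intersection of subfields inherits each closure property. *)
Lemma gelfond_divring : [/\ K 1, forall z w, K z -> K w -> K (z - w) &
  forall z w, K z -> K w -> K (z / w)].
Proof.
split=> [L [[L1 _ _] _]|z w Kz Kw L HL|z w Kz Kw L HL].
- by move: L1; rewrite inE.
- have [[_ LB _] _] := HL; have := LB z w; rewrite !inE; apply; first exact: Kz.
  exact: Kw.
- have [[_ _ LV] _] := HL; have := LV z w; rewrite !inE; apply; first exact: Kz.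
  exact: Kw.
Qed.

Lemma gelfond1 : K 1. Proof. by case: gelfond_divring. Qed.

Lemma gelfondB z w : K z -> K w -> K (z - w).
Proof. by case: gelfond_divring => _ + _; apply. Qed.

Lemma gelfond_div z w : K z -> K w -> K (z / w).
Proof. by case: gelfond_divring => _ _; apply. Qed.

Lemma gelfond0 : K 0.
Proof. by rewrite -(subrr 1); exact: gelfondB gelfond1 gelfond1. Qed.

Lemma gelfondN z : K z -> K (- z).
Proof. by rewrite -sub0r; exact: gelfondB gelfond0. Qed.

Lemma gelfondD z w : K z -> K w -> K (z + w).
Proof.
by move=> Kz Kw; rewrite -[w]opprK; apply: gelfondB => //; exact: gelfondN.
Qed.

Lemma gelfondV z : K z -> K z^-1.
Proof. by rewrite -div1r; exact: gelfond_div gelfond1. Qed.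

Lemma gelfondM z w : K z -> K w -> K (z * w).
Proof.
by move=> Kz Kw; rewrite -[w]invrK; apply: gelfond_div => //; exact: gelfondV.
Qed.

Lemma gelfondX z n : K z -> K (z ^+ n).
Proof.
move=> Kz; elim: n => [|n IH]; first exact: gelfond1.
by rewrite exprS; exact: gelfondM.
Qed.

Lemma gelfond_cexp (p q : rat) : K (cexp ((pi * ratr p) +i* (pi * ratr q))).
Proof. by move=> L [_]; apply; exists (p, q). Qed.

Lemma gelfond_expR q : K (expR (- (pi * ratr q)))%:C.
Proof.
have := gelfond_cexp (- q) 0.
by rewrite /cexp /= rmorph0 mulr0 cos0 sin0 mulr1 rmorphN mulrN.
Qed.

(** $e^{i\tau q} = e^{\pi\xi}$ with $\xi = 2qi$, because $\tau = 2\pi$. *)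
Lemma gelfond_echar q : K (echar (ratr q)).
Proof.
have := gelfond_cexp 0 (q *+ 2).
by rewrite rmorph0 mulr0 /echar /tau rmorphMn /= mulrnAr -mulrnAl -mulr_natl.
Qed.

(** * Characters and roots of unity *)

Lemma echar0 : echar (0 : R) = 1.
Proof. by rewrite echarE mulr0 cos0 sin0. Qed.

Lemma echarX a n : echar a ^+ n = echar (a *+ n).
Proof.
elim: n => [|n IH]; first by rewrite mulr0n echar0.
by rewrite exprS IH -echarD mulrS.
Qed.

Lemma echar_neq0 a : echar a != 0.
Proof.
apply/eqP => E; have := echarD a (- a).
by rewrite subrr echar0 E mul0r => /eqP; rewrite oner_eq0.
Qed.

Lemma echarN a : echar (- a) = (echar a)^-1.
Proof.
apply: (mulIf (echar_neq0 a)).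
by rewrite -echarD addNr echar0 mulVf ?echar_neq0.
Qed.

Lemma echar1 : echar (1 : R) = 1.
Proof.
by rewrite echarE mulr1 /tau mulr_natl cos2pi sin2pi.
Qed.

(** The real part is $\cos(2\pi a) = 1 - 2\sin^2(\pi a)$, and $\sin(\pi a) > 0$. *)
Lemma echar_neq1 a : 0 < a < 1 -> echar a != 1.
Proof.
move=> /andP[a0 a1]; apply/eqP; rewrite echarE => /(congr1 (@complex.Re R)) /= /eqP.
have s0 : 0 < sin (pi * a).
  rewrite sin_gt0_pi// mulr_gt0 ?pi_gt0//=.
  by rewrite -[ltRHS]mulr1 ltr_pM2l ?pi_gt0.
rewrite (_ : tau * a = (pi * a) *+ 2); last by rewrite /tau -mulrA mulr_natl.
rewrite cos_mulr2n => /eqP.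
by have := cos2Dsin2 (pi * a); nra.
Qed.

Lemma echar_prim_root n : (0 < n)%N -> n.-primitive_root (echar (n%:R^-1 : R)).
Proof.
move=> n0; have n0' : 0 < n%:R :> R by rewrite ltr0n.
rewrite /primitive_root_of_unity n0; apply/forallP => i; apply/eqP.
rewrite unity_rootE echarX -[_^-1 *+ _]mulr_natl.
have [->|ni] := eqVneq i.+1 n.
  by rewrite divff ?(lt0r_neq0 n0')// echar1 eqxx.
apply/negbTE/echar_neq1; rewrite divr_gt0 ?ltr0n//= ltr_pdivrMr// mul1r ltr_nat.
by rewrite ltn_neqAle ni /= ltn_ord.
Qed.

(** Every $n$-th root of unity is a power of the primitive one $e^{i\tau/n}$. *)
Lemma gelfond_unity z n : (0 < n)%N -> z ^+ n = 1 -> K z.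
Proof.
move=> n0 zn; have [i ->] := prim_rootP (echar_prim_root n0) zn.
apply: gelfondX; have := gelfond_echar n%:R^-1.
by rewrite fmorphV /= ratr_nat.
Qed.

(** Both sides are the value at 1 of $(X^{n+1}-1)/(X-1)$, written once as a product of linear
    factors and once as a geometric sum. *)
Lemma prod_1Bprim_root (F : fieldType) n (x : F) :
  n.+1.-primitive_root x -> \prod_(i < n) (1 - x ^+ i.+1) = n.+1%:R.
Proof.
move=> px; have := factor_Xn_sub_1 px.
have X1 : 'X - 1 != 0 :> {poly F} by rewrite -polyC1 polyXsubC_eq0.
rewrite big_nat_recl// expr0 polyC1 big_mkord subrX1.
move=> /(mulfI X1)/(congr1 (fun p => p.[1])).
rewrite horner_prod horner_sum => E.
rewrite -[RHS](_ : \sum_(i < n.+1) ('X ^+ i : {poly F}).[1] = _).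
  by rewrite -E; apply: eq_bigr => i _; rewrite !hornerE.
rewrite (eq_bigr (fun=> 1)) ?sumr_const ?card_ord// => i _.
by rewrite hornerXn expr1n.
Qed.

(** Strong induction: an even [n] reduces to [n./2] by a square root of 2, and an odd [n] is a
    product over nontrivial roots of unity whose factors pair into squares. The sign of the root is
    left open. *)
Lemma gelfond_sqrt_nat n : exists2 z : C, K z & z ^+ 2 = n%:R.
Proof.
have Kq q : K (echar (ratr q)) by exact: gelfond_echar.
have i2 : echar (4^-1 : R) ^+ 2 = -1.
  rewrite echarX echarE (_ : tau * _ = pi) ?cospi ?sinpi//.
    by apply/eqP; rewrite eq_complex /= oppr0 !eqxx.
  by rewrite /tau -[_ *+ 2]mulr_natl; field.
have Ki : K (echar (4^-1 : R)).
  by have := Kq 4^-1; rewrite fmorphV /= ratr_nat.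
elim/ltn_ind: n => n IH; case: (posnP n) => [->|n0].
  by exists 0; [exact: gelfond0|rewrite expr0n].
have [nodd|neven] := boolP (odd n); last first.
  have [|z Kz z2] := IH n./2; first by rewrite -divn2 ltn_Pdiv.
  (* The factor is a square root of 2: $(1+i)^2 = 2i$ and $(e^{i\tau/8})^2 = i$. *)
  exists ((1 + echar 4^-1) / echar 8^-1 * z).
    apply: gelfondM => //; apply: gelfond_div.
      exact: gelfondD gelfond1 Ki.
    by have := Kq 8^-1; rewrite fmorphV /= ratr_nat.
  rewrite exprMn z2 expr_div_n sqrrD i2 echarX.
  rewrite (_ : 8^-1 *+ 2 = 4^-1 :> R); last first.
    by rewrite -[_^-1 *+ _]mulr_natl; field.
  rewrite expr1n mul1r addrAC subrr add0r -mulr_natl mulfK ?echar_neq0//.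
  by rewrite -natrM mul2n even_halfK.
set m := n./2; have nE : n = (m + m).+1.
  by rewrite addnn -add1n -{1}(odd_double_half n) nodd.
pose t k : R := k%:R / n%:R.
have Kt k : K (echar (t k)).
  by have := Kq (k%:R / n%:R); rewrite fmorph_div /= !ratr_nat.
(* (1 - zeta^k) (1 - zeta^-k) = u k ^ 2, as i^2 = -1. *)
pose u k := echar (4^-1 - t k / 2) * (1 - echar (t k)).
exists (\prod_(i < m) u i.+1).
  elim/big_ind: _ => [||i _]; [exact: gelfond1|exact: gelfondM|].
  apply: gelfondM; last exact: gelfondB gelfond1 (Kt _).
  have := Kq (4^-1 - (i.+1%:R / n%:R) / 2).
  by rewrite rmorphB fmorphV !fmorph_div /= !ratr_nat.
have -> : n%:R = \prod_(i < m + m) (1 - echar (n%:R^-1 : R) ^+ i.+1).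
  by rewrite prod_1Bprim_root -nE//; exact: echar_prim_root.
have n0' : n%:R != 0 :> R by rewrite pnatr_eq0 -lt0n.
(* Reversing the second half of the product pairs $\zeta^{i+1}$ with $\zeta^{n-(i+1)}$, its
   inverse. *)
rewrite big_split_ord /= [X in _ = _ * X](reindex_inj rev_ord_inj) /=.
rewrite -big_split -prodrXl /=; apply: eq_bigr => i _.
have -> : echar (n%:R^-1 : R) ^+ i.+1 = echar (t i.+1).
  by rewrite echarX -[_^-1 *+ _]mulr_natl.
have -> : echar (n%:R^-1 : R) ^+ (m + (m - i.+1)).+1 = (echar (t i.+1))^-1.
  rewrite echarX -[_^-1 *+ _]mulr_natl -echarN -[RHS]mul1r -echar1 -echarD.
  have -> : (m + (m - i.+1)).+1 = (n - i.+1)%N by have := ltn_ord i; lia.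
  rewrite natrB; last by have := ltn_ord i; lia.
  by rewrite mulrBl divff.
rewrite /u exprMn echarX mulrnBl -[_ / 2 *+ 2]mulr_natl [2 * _]mulrC.
rewrite divfK ?pnatr_eq0// echarD -echarX i2 echarN.
by move: (echar (t i.+1)) (echar_neq0 (t i.+1)) => e e0; field.
Qed.

(** The roots found for numerator and denominator have a quotient whose square is [q]; it is plus or
    minus the real root, and the field is closed under negation. *)
Lemma gelfond_sqrt q : 0 < q -> K (Num.sqrt (ratr q : R))%:C.
Proof.
move=> q0.
have [z Kz z2] : exists2 z : C, K z & z ^+ 2 = (ratr q)%:C.
  have [x Kx x2] := gelfond_sqrt_nat `|numq q|.
  have [y Ky y2] := gelfond_sqrt_nat `|denq q|.
  exists (x / y); first exact: gelfond_div.
  rewrite expr_div_n x2 y2 /ratr rmorphM fmorphV /= !rmorph_int.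
  rewrite -{2}(gez0_abs (ltW (denq_gt0 q))) -{2}(gez0_abs (_ : 0 <= numq q))//.
  by rewrite numq_ge0 ltW.
have : z ^+ 2 == (Num.sqrt (ratr q : R))%:C ^+ 2.
  by rewrite z2 -rmorphXn /= sqr_sqrtr// ler0q ltW.
rewrite eqf_sqr => /orP[/eqP <-//|/eqP zE].
by rewrite -[_%:C]opprK -zE; exact: gelfondN.
Qed.

End gelfond_field.

(** * The span of the rational wave packets *)

Section rational_gaussians.
Context {R : realType}.
Local Notation C := R[i].
Implicit Types (s t : R -> C) (c : C) (a b m r x y : R) (q alpha mu rho : rat).
Local Notation K := (@gelfond R).
Local Notation Q := (@rational_gaussians R).
Local Notation qpacket alpha mu rho :=
  (@packet R (ratr alpha) (ratr mu) (ratr rho)).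

Lemma rational_gaussians0 : Q (fun=> 0).
Proof.
exists 0, (fun=> 0), (fun=> 0), (fun=> 0), (fun=> 0).
by split=> [[]//|[]//|]; apply/funext => x; rewrite big_ord0.
Qed.

Lemma rational_gaussians_cons c alpha mu rho s : K c -> 0 < rho -> Q s ->
  Q (fun x => c * qpacket alpha mu rho x + s x).
Proof.
move=> Kc rho0 [n [d [A [M [P [Kd P0 ->]]]]]].
(* [cons] prepends [z] to a family: index [ord0] gets [z], and [lift ord0 i] gets [f i]. *)
pose cons T (z : T) (f : 'I_n -> T) j := oapp f z (unlift ord0 j).
exists n.+1, (cons _ c d), (cons _ alpha A), (cons _ mu M), (cons _ rho P).
split.
- by move=> j; rewrite /cons; case: unliftP => //=.
- by move=> j; rewrite /cons; case: unliftP => //=.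
- apply/funext => x; rewrite big_ord_recl /cons unlift_none /=; congr (_ + _).
  by apply: eq_bigr => i _; rewrite liftK.
Qed.

(** Turns the finite sums of the definition into an induction on single packets, so that each
    closure property reduces to a computation with packets. *)
Lemma rational_gaussians_ind (P : (R -> C) -> Prop) :
  P (fun=> 0) ->
  (forall c alpha mu rho s, K c -> 0 < rho -> Q s -> P s ->
     P (fun x => c * qpacket alpha mu rho x + s x)) ->
  forall s, Q s -> P s.
Proof.
move=> P0 PS s [n]; elim: n s => [|n IH] s [c [A [M [P' [Kc P'0 ->]]]]].
  by rewrite (_ : (fun x => _) = fun=> 0)//; apply/funext => x; rewrite big_ord0.
pose s' x := \sum_(j < n) c (lift ord0 j) *
  (modulation (ratr (A (lift ord0 j))) x *
   gaussian (ratr (M (lift ord0 j))) (ratr (P' (lift ord0 j))) x).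
(* The length [n] stays explicit, since the induction hypothesis speaks of sums with exactly [n]
   terms. *)
have Qs' : exists (c : 'I_n -> C) (alpha mu rho : 'I_n -> rat),
    [/\ forall j, K (c j), forall j, 0 < rho j &
      s' = fun x => \sum_(j < n) c j * (modulation (ratr (alpha j)) x *
               gaussian (ratr (mu j)) (ratr (rho j)) x)].
  exists (c \o lift ord0), (A \o lift ord0), (M \o lift ord0), (P' \o lift ord0).
  by split => /=.
rewrite (_ : (fun x => _) = fun x =>
  c ord0 * qpacket (A ord0) (M ord0) (P' ord0) x + s' x).
  by apply: PS => //; [exists n|exact: IH].
by apply/funext => x; rewrite big_ord_recl.
Qed.

Lemma rational_gaussiansD s t : Q s -> Q t -> Q (fun x => s x + t x).
Proof.
move=> Qs Qt; elim/rational_gaussians_ind: s / Qs.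
  by under eq_fun do rewrite add0r.
move=> c al mu rho s Kc rho0 _ IH.
by under eq_fun do rewrite -addrA; exact: rational_gaussians_cons.
Qed.

Lemma rational_gaussiansZ c s : K c -> Q s -> Q (fun x => c * s x).
Proof.
move=> Kc Qs; elim/rational_gaussians_ind: s / Qs.
  by under eq_fun do rewrite mulr0; exact: rational_gaussians0.
move=> d al mu rho s Kd rho0 _ IH.
under eq_fun do rewrite mulrDr mulrA.
by apply: rational_gaussians_cons => //; exact: gelfondM.
Qed.

Lemma rational_gaussians_packet alpha mu rho : 0 < rho -> Q (qpacket alpha mu rho).
Proof.
move=> rho0; rewrite (_ : packet _ _ _ =
    fun x => 1 * qpacket alpha mu rho x + (fun=> 0) x).
  apply: rational_gaussians_cons => //; first exact: gelfond1.
  exact: rational_gaussians0.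
by apply/funext => x; rewrite mul1r addr0.
Qed.

(** Completing the square: $r(x-m)^2 + u(x-n)^2$ is $(r+u)$ times the squared distance from [x] to
    the weighted mean of the centres, plus $\frac{ru}{r+u}(m-n)^2$. *)
Lemma packetM a m r b n (u : R) x : r + u != 0 ->
  packet a m r x * packet b n u x =
  (expR (- (pi * (r * u / (r + u) * (m - n) ^+ 2))))%:C *
  packet (a + b) ((r * m + u * n) / (r + u)) (r + u) x.
Proof.
move=> ru; rewrite /packet /modulation /gaussian [(a + b) * x]mulrDl echarD.
rewrite mulrACA [RHS]mulrCA; congr (_ * _).
rewrite -!(rmorphM (real_complex R)) -!expRD /=; congr (expR _)%:C.
by move: (pi : R) => p; field.
Qed.

(** In [y], the reflected factor is $e^{i\tau bx}$ times the packet of frequency $-b$ centred at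
    $x-n$. Thus the integrand of a convolution is a multiple of one packet. *)
Lemma packet_mul_reflect a m r b n (u : R) x y : r + u != 0 ->
  packet a m r y * packet b n u (x - y) =
  (echar (b * x) * (expR (- (pi * (r * u / (r + u) * (m - (x - n)) ^+ 2))))%:C) *
  packet (a - b) ((r * m + u * (x - n)) / (r + u)) (r + u) y.
Proof.
move=> ru; rewrite -mulrA -packetM// [RHS]mulrCA; congr (_ * _).
rewrite /packet /modulation /gaussian [RHS]mulrA; congr (_ * _).
  by rewrite -echarD; congr echar; ring.
by congr (expR (- (_ * _)))%:C; ring.
Qed.

(** After integration, [x] occurs in a character and in a Gaussian centred at $m+n$; splitting the
    character into its constant and its linear part gives the new packet. *)
Lemma convolution_packet a m r b n (u : R) : 0 < r -> 0 < u ->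
  convolution (packet a m r) (packet b n u) = fun x =>
  (((Num.sqrt (r + u))^-1 * expR (- (pi * ((a - b) ^+ 2 / (r + u)))))%:C *
   echar ((a - b) * (r * m - u * n) / (r + u))) *
  packet (b + (a - b) * u / (r + u)) (m + n) (r * u / (r + u)) x.
Proof.
move=> r0 u0; have ru0 : 0 < r + u by exact: addr_gt0.
have ru : r + u != 0 by rewrite gt_eqF.
apply/funext => x; rewrite /convolution.
under [fun y => _]eq_fun do rewrite packet_mul_reflect//.
rewrite cintegralZ; last exact: cgauss_class_packet.
rewrite cintegral_packet// /packet /modulation /gaussian.
have -> : pi * (r * u / (r + u) * (m - (x - n)) ^+ 2) =
    pi * (r * u / (r + u)) * (x - (m + n)) ^+ 2 by ring.
have : echar (b * x) * echar ((a - b) * ((r * m + u * (x - n)) / (r + u))) =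
    echar ((a - b) * (r * m - u * n) / (r + u)) *
    echar ((b + (a - b) * u / (r + u)) * x).
  by rewrite -!echarD; congr echar; field.
move: (echar _) (echar _) (echar _) (echar _) (_%:C) (_%:C) => e1 e2 e3 e4 k1 k2 E.
by transitivity (k1 * k2 * (e4 * e3)); [ring|rewrite E; ring].
Qed.

(** The kernel only raises the frequency from [a] to $a+\xi$, so the integral of a packet applies;
    its Gaussian factor in $a+\xi$ is centred at $-a$. *)
Lemma fourier_packet a m r : 0 < r ->
  fourier (packet a m r) = fun xi =>
  ((Num.sqrt r)^-1%:C * echar (a * m)) * packet m (- a) r^-1 xi.
Proof.
move=> r0; apply/funext => xi; rewrite /fourier.
rewrite (_ : (fun x => _) = packet (a + xi) m r); last first.
  apply/funext => x; rewrite /packet /modulation [LHS]mulrA -echarD.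
  by congr (echar _ * _); ring.
rewrite cintegral_packet// (rmorphM (real_complex R)) /packet /modulation /gaussian /=.
have -> : pi * ((a + xi) ^+ 2 / r) = pi * r^-1 * (xi - - a) ^+ 2.
  by rewrite opprK; ring.
rewrite [(a + xi) * m]mulrDl echarD [xi * m]mulrC.
move: (echar _) (echar _) (_%:C) (_%:C) => e1 e2 k1 k2; ring.
Qed.

Lemma heis_act_packet c x0 xi a m r : heis_act (Heis c x0 xi) (packet a m r) =
  fun x => c * echar (- ((a + xi) * x0)) * packet (a + xi) (m + x0) r x.
Proof.
apply/funext => x.
rewrite /heis_act /translate /modulate /packet /modulation /gaussian /=.
have -> : x - x0 - m = x - (m + x0) by ring.
have : echar (- ((a + xi) * x0)) * echar ((a + xi) * x) =
    echar (xi * (x - x0)) * echar (a * (x - x0)).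
  by rewrite -!echarD; congr echar; ring.
move: (echar _) (echar _) (echar _) (echar _) (_%:C) => e1 e2 e3 e4 k1 E.
by rewrite -mulrA [X in _ = _ * X]mulrA E; ring.
Qed.

(** * Closure properties of the rational span *)

Definition ratr_morphE :=
  (@rmorphD, @rmorphB, @rmorphN, @rmorphM, @rmorphXn, @fmorphV).

Lemma rational_gaussiansM s t : Q s -> Q t -> Q (s \* t).
Proof.
move=> Qs Qt; elim/rational_gaussians_ind: s / Qs.
  rewrite (_ : _ \* _ = fun=> 0); first exact: rational_gaussians0.
  by apply/funext => x /=; rewrite mul0r.
move=> c al mu rho s Kc rho0 Qs IH.
rewrite (_ : _ \* _ =
    fun x => c * (qpacket al mu rho x * t x) + (s \* t) x); last first.
  by apply/funext => x /=; rewrite mulrDl mulrA.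
apply: rational_gaussiansD => //; apply: rational_gaussiansZ => //.
elim/rational_gaussians_ind: t / Qt {IH}.
  by under eq_fun do rewrite mulr0; exact: rational_gaussians0.
move=> d be nu sg t Kd sg0 Qt IH; under eq_fun do rewrite mulrDr mulrCA.
apply: rational_gaussiansD => //; apply: rational_gaussiansZ => //.
have rs0 : ratr rho + ratr sg != 0 :> R.
  by rewrite -rmorphD gt_eqF// ltr0q addr_gt0.
under eq_fun do rewrite packetM//.
apply: rational_gaussiansZ.
  have := @gelfond_expR R (rho * sg / (rho + sg) * (mu - nu) ^+ 2).
  by rewrite !ratr_morphE.
have := @rational_gaussians_packet (al + be)
  ((rho * mu + sg * nu) / (rho + sg)) (rho + sg).
by rewrite !ratr_morphE; apply; exact: addr_gt0.
Qed.

(** Membership of the integrand in the class is carried through the induction, because splitting the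
    integral of a sum needs integrability of both terms. *)
Lemma rational_gaussians_fourier s : Q s ->
  (forall xi, cgauss_class (fun x => echar (x * xi) * s x)) /\ Q (fourier s).
Proof.
elim/rational_gaussians_ind=> [|c al mu rho s' Kc rho0 Qs [Gs Fs]].
  split=> [xi|]; first by under eq_fun do rewrite mulr0; exact: cgauss_class0.
  rewrite /fourier; under eq_fun => xi.
    under [fun x => _]eq_fun do rewrite mulr0.
    rewrite cintegral0; over.
  exact: rational_gaussians0.
have rho0' : 0 < ratr rho :> R by rewrite ltr0q.
have Gp xi : cgauss_class (fun x => echar (x * xi) * qpacket al mu rho x).
  rewrite (_ : (fun x => _) = packet (ratr al + xi) (ratr mu) (ratr rho)).
    exact: cgauss_class_packet.
  apply/funext => x; rewrite /packet /modulation [LHS]mulrA -echarD.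
  by congr (echar _ * _); ring.
have E xi : (fun x => echar (x * xi) * (c * qpacket al mu rho x + s' x)) =
    fun x => c * (echar (x * xi) * qpacket al mu rho x) + echar (x * xi) * s' x.
  by apply/funext => x; rewrite mulrDr mulrCA.
split=> [xi|]; first by rewrite E; apply: cgauss_classD => //; exact: cgauss_classZ.
rewrite (_ : fourier _ = fun xi =>
    c * fourier (qpacket al mu rho) xi + fourier s' xi); last first.
  apply/funext => xi; rewrite /fourier E cintegralD//; last exact: cgauss_classZ.
  by rewrite cintegralZ.
apply: rational_gaussiansD => //; apply: rational_gaussiansZ => //.
rewrite fourier_packet//; apply: rational_gaussiansZ.
  apply: gelfondM; last by rewrite -rmorphM; exact: gelfond_echar.
  rewrite (fmorphV (real_complex R)) /=; apply: gelfondV; exact: gelfond_sqrt.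
by rewrite -rmorphN -fmorphV; apply: rational_gaussians_packet; rewrite invr_gt0.
Qed.

(** Bilinearity by two nested inductions, again with the integrability of the integrand carried
    along. *)
Lemma rational_gaussians_convolution s t : Q s -> Q t ->
  (forall x, cgauss_class (fun y => s y * t (x - y))) /\ Q (convolution s t).
Proof.
move=> Qs Qt.
elim/rational_gaussians_ind: s / Qs => [|c al mu rho s Kc rho0 Qs [Gs Cs]].
  split=> [x|]; first by under eq_fun do rewrite mul0r; exact: cgauss_class0.
  rewrite /convolution; under eq_fun => x.
    under [fun y => _]eq_fun do rewrite mul0r.
    rewrite cintegral0; over.
  exact: rational_gaussians0.
have rho0' : 0 < ratr rho :> R by rewrite ltr0q.
(* Inner induction, on [t], with a single packet as left factor. *)
have [Gp Cp] : (forall x, cgauss_class (fun y => qpacket al mu rho y * t (x - y))) /\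
    Q (convolution (qpacket al mu rho) t).
  elim/rational_gaussians_ind: t / Qt {Gs Cs} =>
    [|d be nu sg t Kd sg0 Qt [Gt Ct]].
    split=> [x|]; first by under eq_fun do rewrite mulr0; exact: cgauss_class0.
    rewrite /convolution; under eq_fun => x.
      under [fun y => _]eq_fun do rewrite mulr0.
      rewrite cintegral0; over.
    exact: rational_gaussians0.
  have sg0' : 0 < ratr sg :> R by rewrite ltr0q.
  have rs0 : 0 < ratr rho + ratr sg :> R by exact: addr_gt0.
  have E x : (fun y => qpacket al mu rho y *
                       (d * qpacket be nu sg (x - y) + t (x - y))) =
      fun y => d * (qpacket al mu rho y * qpacket be nu sg (x - y)) +
        qpacket al mu rho y * t (x - y).
    by apply/funext => y; rewrite mulrDr mulrCA.
  have Gpp x :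
      cgauss_class (fun y => qpacket al mu rho y * qpacket be nu sg (x - y)).
    under eq_fun do rewrite packet_mul_reflect ?gt_eqF//.
    by apply/cgauss_classZ/cgauss_class_packet.
  split=> [x|]; first by rewrite E; apply: cgauss_classD => //; exact: cgauss_classZ.
  rewrite (_ : convolution _ _ = fun x =>
    d * convolution (qpacket al mu rho) (qpacket be nu sg) x +
    convolution (qpacket al mu rho) t x); last first.
    apply/funext => x; rewrite /convolution E cintegralD//; last exact: cgauss_classZ.
    by rewrite cintegralZ.
  apply: rational_gaussiansD => //; apply: rational_gaussiansZ => //.
  rewrite convolution_packet//; apply: rational_gaussiansZ.
    apply: gelfondM.
      rewrite (rmorphM (real_complex R)); apply: gelfondM.
        rewrite (fmorphV (real_complex R)) -(@rmorphD _ _ (@ratr R)) /=.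
        by apply: gelfondV; apply: gelfond_sqrt; exact: addr_gt0.
      have := @gelfond_expR R ((al - be) ^+ 2 / (rho + sg)).
      by rewrite !ratr_morphE.
    have := @gelfond_echar R ((al - be) * (rho * mu - sg * nu) / (rho + sg)).
    by rewrite !ratr_morphE.
  have := @rational_gaussians_packet (be + (al - be) * sg / (rho + sg)) (mu + nu)
    (rho * sg / (rho + sg)).
  by rewrite !ratr_morphE; apply; rewrite divr_gt0 ?mulr_gt0 ?addr_gt0.
have E x : (fun y => (c * qpacket al mu rho y + s y) * t (x - y)) =
    fun y => c * (qpacket al mu rho y * t (x - y)) + s y * t (x - y).
  by apply/funext => y; rewrite mulrDl mulrA.
split=> [x|]; first by rewrite E; apply: cgauss_classD => //; exact: cgauss_classZ.
rewrite (_ : convolution _ _ = fun x =>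
  c * convolution (qpacket al mu rho) t x + convolution s t x); last first.
  apply/funext => x; rewrite /convolution E cintegralD//; last exact: cgauss_classZ.
  by rewrite cintegralZ.
by apply: rational_gaussiansD => //; exact: rational_gaussiansZ.
Qed.

Lemma rational_gaussians_heis h s : heisenbergQ h -> Q s -> Q (heis_act h s).
Proof.
case: h => c x0 xi [[n n0 /= cn] [p /= ->] [q /= ->]] {x0 xi} Qs.
elim/rational_gaussians_ind: s / Qs => [|d al mu rho s Kd rho0 Qs IH].
  rewrite (_ : heis_act _ _ = fun=> 0); first exact: rational_gaussians0.
  by apply/funext => x; rewrite /heis_act /translate /modulate !mulr0.
rewrite (_ : heis_act _ _ = fun x =>
    d * heis_act (Heis c (ratr p) (ratr q)) (qpacket al mu rho) x +
    heis_act (Heis c (ratr p) (ratr q)) s x); last first.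
  apply/funext => x; rewrite /heis_act /translate /modulate /=.
  move: (packet _ _ _ _) (modulation _ _) (s _) => u v w; ring.
apply: rational_gaussiansD => //; apply: rational_gaussiansZ => //.
rewrite heis_act_packet; apply: rational_gaussiansZ.
  apply: gelfondM; first exact: gelfond_unity cn.
  by have := @gelfond_echar R (- ((al + q) * p)); rewrite !ratr_morphE.
by rewrite -!rmorphD; exact: rational_gaussians_packet.
Qed.

Lemma rational_gaussians_cgauss_class s : Q s -> cgauss_class s.
Proof.
elim/rational_gaussians_ind=> [|c al mu rho s' Kc rho0 Qs IH].
  exact: cgauss_class0.
apply: cgauss_classD => //; apply/cgauss_classZ/cgauss_class_packet.
by rewrite ltr0q.
Qed.

Lemma twain_subsinglet_rational_gaussians : twain_subsinglet K Q.
Proof.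
split.
- split.
    by move=> s /rational_gaussians_cgauss_class; exact: cgauss_class_schwartz.
  split; [exact: rational_gaussians0|exact: rational_gaussiansD|].
  exact: rational_gaussiansZ.
- by move=> s t Qs Qt; case: (rational_gaussians_convolution Qs Qt).
- exact: rational_gaussiansM.
- exact: rational_gaussians_heis.
- by move=> s Qs; case: (rational_gaussians_fourier Qs).
Qed.

Lemma gaussianE m r : gaussian m r = packet 0 m r.
Proof.
by apply/funext => x; rewrite /packet /modulation mul0r echar0 mul1r.
Qed.

End rational_gaussians.

(** * Every twain subsinglet containing the unit Gaussian contains the span *)

Section minimality.
Context {R : realType}.
Context (V : set (R -> R[i])).
Context (twainV : twain_subsinglet gelfond V) (V_gaussian : V (gaussian 0 1)).
Implicit Types (a b r : R) (s : R -> R[i]).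

Let V0 : V (fun=> 0). Proof. by case: twainV => -[_ []]. Qed.
Let VD s t : V s -> V t -> V (fun x => s x + t x).
Proof. by case: twainV => -[_ [_ + _]] _ _ _ _; apply. Qed.
Let VZ c s : gelfond c -> V s -> V (fun x => c * s x).
Proof. by case: twainV => -[_ [_ _ +]] _ _ _ _; apply. Qed.

Lemma gaussian0D a b : gaussian 0 (a + b) = gaussian 0 a \* gaussian 0 b.
Proof.
apply/funext => x; rewrite /gaussian /= -(rmorphM (real_complex R)) -expRD.
by congr (expR _)%:C; rewrite mulrDr mulrDl opprD.
Qed.

(** The pointwise power of exponent [n.+1]. *)
Lemma gaussian0Mn r n : V (gaussian 0 r) -> V (gaussian 0 (r *+ n.+1)).
Proof.
move=> Vr; elim: n => [|n IH]; first by rewrite mulr1n.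
by rewrite mulrS gaussian0D; case: twainV => _ _ + _ _; apply.
Qed.

(** The Fourier transform inverts the parameter of a centred Gaussian at the cost of the constant
    $(n+1)^{-1/2}$, which a scalar of the Gelfond field cancels. *)
Lemma gaussian0V n : V (gaussian 0 n.+1%:R^-1).
Proof.
have n0 : 0 < n.+1%:R :> R by rewrite ltr0n.
have Vn : V (gaussian 0 n.+1%:R) by exact: gaussian0Mn.
have Vf : V (fourier (gaussian 0 n.+1%:R)) by case: twainV => _ _ _ _; apply.
have Ks : gelfond (Num.sqrt n.+1%:R : R)%:C.
  by have := @gelfond_sqrt R n.+1%:R; rewrite ratr_nat; apply; rewrite ltr0n.
have := VZ Ks Vf; rewrite gaussianE fourier_packet// mul0r echar0 oppr0 gaussianE.
rewrite (_ : (fun x => _) = packet 0 0 n.+1%:R^-1)//; apply/funext => x.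
rewrite mulr1 mulrA -(rmorphM (real_complex R)) divff ?mul1r//.
Qed.

Lemma gaussian0_rat (rho : rat) : 0 < rho -> V (gaussian 0 (ratr rho)).
Proof.
move=> rho0.
(* Numerator and denominator are positive, hence successors, as the two preceding lemmas require. *)
have nE : numq rho = `|numq rho|.-1.+1 :> int.
  by rewrite prednK ?gez0_abs ?absz_gt0 ?numq_eq0 ?gt_eqF ?numq_ge0 ?ltW.
have dE : denq rho = `|denq rho|.-1.+1 :> int.
  by rewrite prednK ?gez0_abs ?absz_gt0 ?denq_neq0 ?ltW ?denq_gt0.
have := gaussian0Mn `|numq rho|.-1 (gaussian0V `|denq rho|.-1).
by rewrite -[_^-1 *+ _]mulr_natl /ratr {2}nE {2}dE.
Qed.

(** Translation by [mu] and modulation by [al] carry a centred Gaussian to any packet up to a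
    unimodular constant; linearity does the rest. *)
Lemma rational_gaussians_least : rational_gaussians `<=` V.
Proof.
apply: rational_gaussians_ind => // c al mu rho s Kc rho0 _ Vs.
apply: VD => //; apply: VZ => //.
have H : heisenbergQ (Heis (1 : R[i]) (ratr mu) (ratr al)).
  by split => /=; [exists 1%N; rewrite ?expr1n|exists mu|exists al].
have Vh : V (heis_act (Heis 1 (ratr mu) (ratr al)) (gaussian 0 (ratr rho))).
  by case: twainV => _ _ _ + _; apply => //; exact: gaussian0_rat.
(* The scalar $e^{i\tau\alpha\mu}$ cancels the constant that arises because the action modulates
   before it translates. *)
have := VZ (gelfond_echar (al * mu)) Vh.
rewrite gaussianE heis_act_packet add0r add0r.
rewrite (_ : (fun x => _) = packet (ratr al) (ratr mu) (ratr rho))//.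
apply/funext => x; rewrite mul1r mulrA -echarD rmorphM /= subrr.
by rewrite echar0 mul1r.
Qed.
End minimality.

Theorem lemma75 (R : realType) :
  [/\ twain_subsinglet (@gelfond R) rational_gaussians,
      rational_gaussians (@gaussian R 0 1) &
      forall V : set (R -> complex R),
        twain_subsinglet gelfond V -> V (gaussian 0 1) ->
        rational_gaussians `<=` V].
Proof.
split; first exact: twain_subsinglet_rational_gaussians.
  have := @rational_gaussians_packet R 0 0 1 ltr01.
  by rewrite !rmorph0 rmorph1 -gaussianE.
by move=> V; exact: rational_gaussians_least.
Qed.
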